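(* Let $n\geq 2$, let $a,b,c,d\in\mathbb{R}$ with $a>0$, and define \[ F(x_1,\dots,x_n)=\frac{a}{n}\sum_{i=1}^n x_i^2+\frac{b}{n^2}\Bigl(\sum_{i=1}^n x_i\Bigr)^2+\frac{c}{n}\sum_{i=1}^n x_i+d. \] Let $S_1,S_2>0$ satisfy $(n-1)S_2<S_1^2<nS_2$, and let $x_1,\dots,x_n$ be positive real numbers with $x_1+\cdots+x_n=S_1$ and $x_1^2+\cdots+x_n^2=S_2$. Let $\Delta=\prod_{i<j}(x_i-x_j)^2$. Then \[ F(x_1,\dots,x_n)\geq \binom{n}{2}\frac{2a}{n}\left(\frac{\Delta}{Y(n)}\right)^{1/\binom{n}{2}}+(a+b)\frac{S_1^2}{n^2}+\frac{cS_1}{n}+d, \] where $Y(n)=2^2\,3^3\cdots n^n$ is the hyperfactorial.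
   Context: $\Delta$ is the discriminant of $x_1,\dots,x_n$. *)

(* Defs.v *)
From mathcomp Require Import all_boot all_order all_algebra.
From mathcomp Require Import reals exp.

Set Implicit Arguments.
Unset Strict Implicit.
Unset Printing Implicit Defensive.

Import Order.TTheory GRing.Theory Num.Theory.

Local Open Scope ring_scope.

Definition discriminant (R : realType) (n : nat) (x : 'rV[R]_n) : R :=
  \prod_(i < n) \prod_(j < n | (i < j)%N) (x 0 i - x 0 j) ^+ 2.

Definition hyperfactorial (n : nat) : nat := (\prod_(2 <= k < n.+1) k ^ k)%N.

Definition F (R : realType) (n : nat) (a b c d : R) (x : 'rV[R]_n) : R :=
  a / n%:R * \sum_(i < n) x 0 i ^+ 2
  + b / n%:R ^+ 2 * (\sum_(i < n) x 0 i) ^+ 2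
  + c / n%:R * \sum_(i < n) x 0 i
  + d.

(* Main.v *)
(* Write V = S2 - S1^2/n = sum (x_i - S1/n)^2. The claim is Stieltjes' bound
   Delta <= Y(n) (V / (n(n-1)))^C(n,2), whose extremal points are the zeros
   h_1 < ... < h_n of the Hermite polynomial He_n. For sorted y, AM-GM over the
   pairs i != j bounds the product of (y_i - y_j)/(h_i - h_j) by a power of
   their mean. The differential equation of He_n gives
   sum_{j != i} 1/(h_i - h_j) = h_i/2, so these ratios sum to sum_i y_i h_i,
   which Cauchy-Schwarz and sum_i h_i^2 = n(n-1) bound by sqrt(V n(n-1)).
   The discriminant of He_n equals Y(n) by the resultant recursion. *)

Require Import Defs.
From mathcomp Require Import all_boot all_order all_algebra.
From mathcomp Require Import reals exp.
From mathcomp Require Import perm separable complex ring zify.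

Set Implicit Arguments.
Unset Strict Implicit.
Unset Printing Implicit Defensive.

Import Order.TTheory GRing.Theory Num.Theory.

Local Open Scope ring_scope.

(** * Hermite polynomials and their real, simple zeros *)

(** The monic (probabilists') [He_n], over any commutative ring so that it can be carried from a
    real field to its complex closure. *)
Fixpoint hermite (R : comNzRingType) (n : nat) : {poly R} :=
  match n with
  | 0 => 1
  | m.+1 => match m with
            | 0 => 'X
            | k.+1 => 'X * hermite R m - hermite R k *+ m
            end
  end.

Lemma hermiteSS (R : comNzRingType) n :
  hermite R n.+2 = 'X * hermite R n.+1 - hermite R n *+ n.+1.
Proof. by []. Qed.

Lemma nat_ind2 (P : nat -> Prop) :
  P 0%N -> P 1%N -> (forall n, P n -> P n.+1 -> P n.+2) -> forall n, P n.
Proof.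
move=> P0 P1 PSS n; suff [] : P n /\ P n.+1 by [].
by elim: n => [//|n [Pn PSn]]; split=> //; apply: PSS.
Qed.

Lemma deriv_hermite (R : comNzRingType) n :
  (hermite R n.+1)^`() = hermite R n *+ n.+1.
Proof.
elim/nat_ind2: n => [|| n IH0 IH1]; first by rewrite derivX.
  by rewrite hermiteSS /= derivB derivM derivX derivMn derivC; ring.
rewrite hermiteSS derivB derivM derivX derivMn IH0 IH1 (hermiteSS R n); ring.
Qed.

(** For index at least 2, [deriv_hermite] turns the equation into a multiple of the three-term
    recurrence. *)
Lemma hermite_ode (R : comNzRingType) n :
  (hermite R n)^`()^`() = 'X * (hermite R n)^`() - hermite R n *+ n.
Proof.
case: n => [|[|n]].
- by rewrite /= derivC deriv0 mulr0 mulr0n subr0.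
- by rewrite /= derivX derivC mulr1 mulr1n subrr.
by rewrite !deriv_hermite derivMn deriv_hermite hermiteSS; ring.
Qed.

Lemma map_hermite (R S : comNzRingType) (f : {rmorphism R -> S}) n :
  map_poly f (hermite R n) = hermite S n.
Proof.
elim/nat_ind2: n => [|| n IH0 IH1]; rewrite ?rmorph1 ?map_polyX //.
by rewrite !hermiteSS rmorphB rmorphM rmorphMn /= map_polyX IH0 IH1.
Qed.

Lemma size_lead_hermite (R : comNzRingType) n :
  size (hermite R n) = n.+1 /\ hermite R n \is monic.
Proof.
elim/nat_ind2: n => [|| n [s0 m0] [s1 m1]].
- by rewrite size_poly1 monic1.
- by rewrite size_polyX monicX.
have sX : size ('X * hermite R n.+1) = n.+3.
  by rewrite mulrC size_mulX ?s1 ?monic_neq0.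
have lt : (size (- (hermite R n *+ n.+1)) < size ('X * hermite R n.+1)%R)%N.
  rewrite sX size_polyN -scaler_nat ltnS.
  by rewrite (leq_trans (size_scale_leq _ _)) // s0 leqnSn.
rewrite hermiteSS size_polyDl // sX; split=> //.
by rewrite monicE lead_coefDl // -monicE monicMl ?monicX.
Qed.

(** A Euclidean step: modulo [He_{n+1}] the recurrence leaves [-(n+1) He_n], a nonzero multiple of
    [He_n] in characteristic zero. *)
Lemma coprimep_hermite (R : numFieldType) n :
  coprimep (hermite R n.+1) (hermite R n).
Proof.
elim: n => [|n IH]; first by rewrite coprimep1.
rewrite coprimep_sym hermiteSS coprimep_addl_mul -scaler_nat -scaleNr.
by rewrite coprimepZr // oppr_eq0 pnatr_eq0.
Qed.

Lemma separable_hermite (R : numFieldType) n : separable_poly (hermite R n).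
Proof.
rewrite separable_poly.unlock; case: n => [|n]; first exact: coprime1p.
by rewrite deriv_hermite -scaler_nat coprimepZr ?coprimep_hermite ?pnatr_eq0.
Qed.

(* Christoffel-Darboux at (z, conj z): the positive sum, cleared of
   denominators, is the witness. *)
Lemma christoffel_darboux_conj (C : numClosedFieldType) (z : C) n :
  exists2 t, 0 < t &
    (z - z^*) * t = (hermite C n.+1).[z] * (hermite C n).[z^*]
                    - (hermite C n).[z] * (hermite C n.+1).[z^*].
Proof.
elim: n => [|n [t t0 IH]].
  by exists 1 => //=; rewrite !hornerE.
exists ((hermite C n.+1).[z] * (hermite C n.+1).[z^*] + n.+1%:R * t).
  have -> : (hermite C n.+1).[z^*] = (hermite C n.+1).[z]^*.
    by rewrite -horner_map map_hermite.
  by rewrite ltr_wpDl ?mul_conjC_ge0 // mulr_gt0 ?ltr0Sn.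
rewrite mulrDr [X in _ + X]mulrCA IH !hermiteSS.
rewrite !(hornerD, hornerN, hornerM, hornerX, hornerMn).
ring.
Qed.

(** At a zero both products in the Christoffel-Darboux identity vanish, since integer coefficients
    make [z^*] a zero too; as [t > 0], this forces [z = z^*]. *)
Lemma root_hermite_real (C : numClosedFieldType) (z : C) n :
  root (hermite C n) z -> z^* = z.
Proof.
case: n => [|n]; first by rewrite /root hornerC oner_eq0.
move=> /rootP rz.
have rz' : (hermite C n.+1).[z^*] = 0.
  by rewrite -(map_hermite Num.conj) horner_map rz rmorph0.
have [t t0] := christoffel_darboux_conj z n.
rewrite rz rz' mul0r mulr0 subrr => /eqP.
by rewrite mulf_eq0 (gt_eqF t0) orbF subr_eq0 => /eqP.
Qed.

(** The polynomial splits over [R[i]]; its zeros are real, so the factorization descends, and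
    separability makes the sorted list strictly increasing. *)
Lemma hermite_split (R : rcfType) n :
  exists s : seq R, [/\ sorted <%R s, size s = n
    & hermite R n = \prod_(z <- s) ('X - z%:P)].
Proof.
have [r] := closed_field_poly_normal (hermite R[i]%C n).
have [sz /monicP ->] := size_lead_hermite R[i]%C n; rewrite scale1r => E.
pose s := [seq complex.Re z | z <- r].
have rE : r = [seq real_complex R x | x <- s].
  rewrite -map_comp -[LHS]map_id; apply/eq_in_map => z zr /=.
  have : root (hermite R[i]%C n) z by rewrite E root_prod_XsubC.
  by move=> /root_hermite_real /CrealP /RRe_real.
have sE : hermite R n = \prod_(z <- s) ('X - z%:P).
  apply: (map_poly_inj (real_complex R)).
  by rewrite map_hermite E rE map_prod_XsubC big_map.
have us : uniq s by rewrite -separable_prod_XsubC -sE separable_hermite.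
exists (sort <=%R s); split.
- by rewrite lt_sorted_uniq_le sort_uniq us sort_le_sorted.
- have := size_lead_hermite R n; rewrite sE size_prod_XsubC size_sort.
  by case=> -[].
- by rewrite sE; apply: perm_big; rewrite perm_sym perm_sort.
Qed.

(** * Derivatives of a split polynomial *)

Lemma deriv_prod_XsubC_horner (F : fieldType) (I : Type) (r : seq I)
    (P : pred I) (h : I -> F) (a : F) : (forall i, P i -> a != h i) ->
  (\prod_(i <- r | P i) ('X - (h i)%:P))^`().[a] =
  (\prod_(i <- r | P i) (a - h i)) * \sum_(i <- r | P i) (a - h i)^-1.
Proof.
move=> ah; elim: r => [|i r IH]; first by rewrite !big_nil derivC horner0 mulr0.
rewrite !big_cons; case: ifP => // Pi.
have nz : a - h i != 0 by rewrite subr_eq0 ah.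
rewrite derivM derivXsubC hornerD !hornerM IH hornerC hornerXsubC horner_prod.
under [in LHS]eq_bigr do rewrite hornerXsubC.
by field.
Qed.

Lemma deriv_prod_XsubC_root (I : finType) (R : comNzRingType) (h : I -> R) i :
  (\prod_j ('X - (h j)%:P))^`().[h i] = \prod_(j | j != i) (h i - h j).
Proof.
rewrite (bigD1 i) //= derivM derivXsubC !hornerE subrr mul0r addr0 horner_prod.
by under eq_bigr do rewrite hornerXsubC.
Qed.

(** Writing the product as [(X - h_i) Q], only [2 Q'(h_i)] survives, and [Q'/Q] is the sum of
    reciprocals. *)
Lemma deriv2_prod_XsubC_root (I : finType) (F : fieldType) (h : I -> F) i :
  injective h ->
  (\prod_j ('X - (h j)%:P))^`()^`().[h i] =
  2%:R * (\prod_(j | j != i) (h i - h j) * \sum_(j | j != i) (h i - h j)^-1).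
Proof.
move=> hI; rewrite (bigD1 i) //= derivM derivXsubC mul1r.
rewrite derivD derivM derivXsubC mul1r.
rewrite -deriv_prod_XsubC_horner; last first.
  by move=> j; apply: contraNneq => /hI ->.
by rewrite !hornerD hornerM hornerXsubC; ring.
Qed.

(** * Stieltjes relations at the Hermite zeros *)

Lemma hermite_zeros (R : rcfType) n :
  exists2 h : 'I_n -> R, {homo h : i j / (i < j)%N >-> i < j}
    & hermite R n = \prod_i ('X - (h i)%:P).
Proof.
have [s [ss sz E]] := hermite_split R n.
exists (fun i => nth 0 s i) => [i j ij|].
  by rewrite lt_sorted_ltn_nth // inE sz.
by rewrite E (big_nth 0) sz big_mkord.
Qed.

Section HermiteZeros.

Variables (R : rcfType) (n : nat) (h : 'I_n -> R).
Hypothesis h_lt : {homo h : i j / (i < j)%N >-> i < j}.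
Hypothesis hE : hermite R n = \prod_i ('X - (h i)%:P).

Lemma homo_ltn_inj : injective h.
Proof.
move=> i j hij; case: (ltngtP i j) => [/h_lt|/h_lt|/val_inj //];
  by rewrite hij ltxx.
Qed.

(** At [h_i] the differential equation reads [He'' = h_i He'], and the quotient [He''/He'] there is
    twice the sum. *)
Lemma hermite_stieltjes i : \sum_(j | j != i) (h i - h j)^-1 = h i / 2%:R.
Proof.
have q0 : \prod_(j | j != i) (h i - h j) != 0.
  by apply/prodf_neq0 => j; apply: contraNneq => /subr0_eq/homo_ltn_inj ->.
have := congr1 (horner^~ (h i)) (hermite_ode R n).
rewrite !(hornerD, hornerN, hornerM, hornerX, hornerMn) hE.
rewrite deriv2_prod_XsubC_root; last exact: homo_ltn_inj.
rewrite deriv_prod_XsubC_root horner_prod [X in X *+ n](bigD1 i) //=.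
rewrite hornerXsubC subrr mul0r mul0rn subr0 mulrCA [RHS]mulrC.
move=> /(mulfI q0) /(congr1 (fun u => u / 2%:R)) <-.
by field.
Qed.

Lemma sum_pair_quotient_hermite (y : 'I_n -> R) :
  \sum_i \sum_(j | j != i) (y i - y j) / (h i - h j) = \sum_i y i * h i.
Proof.
(* Swapping [i] and [j] in the [y j] half flips the sign of the denominator, which makes it a second
   copy of the [y i] half. *)
have -> : \sum_i \sum_(j | j != i) (y i - y j) / (h i - h j)
  = \sum_i \sum_(j | j != i) y i / (h i - h j)
    + \sum_i \sum_(j | j != i) y i / (h i - h j).
  rewrite [X in _ + X](exchange_big_dep xpredT) //= -big_split /=.
  apply: eq_bigr => i _.
  under [X in _ + X]eq_bigl do rewrite eq_sym.
  rewrite -big_split /=; apply: eq_bigr => j ji.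
  by rewrite -(opprB (h i)) invrN mulrN -mulrBl.
rewrite -big_split; apply: eq_bigr => i _ /=.
by rewrite -!mulr_sumr hermite_stieltjes; field.
Qed.

(** The choice [y = h] makes every quotient 1, so the sum counts ordered pairs. *)
Lemma sum_sqr_hermite : \sum_i h i ^+ 2 = (n * n.-1)%:R.
Proof.
under eq_bigr do rewrite expr2.
rewrite -sum_pair_quotient_hermite.
under eq_bigr => i _.
  under eq_bigr => j ji.
    rewrite divff; last first.
      by apply: contraNneq ji => /subr0_eq/homo_ltn_inj ->.
    over.
  rewrite sumr_const cardC1 card_ord; over.
by rewrite sumr_const card_ord -mulrnA mulnC.
Qed.

End HermiteZeros.

(** * Discriminant of the Hermite polynomial *)

Lemma hyperfactorialS n :
  hyperfactorial n.+1 = (hyperfactorial n * n.+1 ^ n.+1)%N.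
Proof.
case: n => [|n]; first by rewrite /hyperfactorial !big_geq.
by rewrite /hyperfactorial big_nat_recr.
Qed.

(* Up to sign the product is the resultant of He_n and He_{n+1}; exchanging
   the two and using the recurrence at the zeros of He_{n+1} lowers n. *)
Lemma hermite_resultant (R : rcfType) n (t : seq R) :
  hermite R n.+1 = \prod_(z <- t) ('X - z%:P) ->
  `|\prod_(z <- t) (hermite R n).[z]| = (hyperfactorial n)%:R.
Proof.
elim: n t => [|n IH] t tE.
  by rewrite big1 ?normr1 /hyperfactorial ?big_geq // => z _; rewrite hornerC.
have [s [_ sz sE]] := hermite_split R n.+1.
transitivity `|\prod_(y <- s) (hermite R n.+2).[y]|.
  rewrite sE tE !normr_prod.
  under eq_bigr do rewrite horner_prod normr_prod.
  rewrite exchange_big; apply: eq_bigr => y _; rewrite horner_prod normr_prod.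
  by apply: eq_bigr => z _; rewrite !hornerXsubC distrC.
have -> : \prod_(y <- s) (hermite R n.+2).[y]
  = \prod_(y <- s) (- n.+1%:R * (hermite R n).[y]).
  apply: eq_big_seq => y ys.
  have /rootP ry : root (hermite R n.+1) y by rewrite sE root_prod_XsubC.
  rewrite hermiteSS !(hornerD, hornerN, hornerM, hornerX, hornerMn) ry.
  by rewrite mulr0 add0r mulNr mulr_natl.
rewrite big_split normrM IH //= big_const_seq count_predT sz iter_mulr_1.
by rewrite normrX normrN normr_nat hyperfactorialS natrM natrX mulrC.
Qed.

(** For [n > 0] the inner product is [|He_n'(h_i)| = n |He_{n-1}(h_i)|], so the whole is [n^n] times
    the absolute resultant of [He_n] and [He_{n-1}]. *)
Lemma hermite_discriminant (R : rcfType) n (h : 'I_n -> R) :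
  hermite R n = \prod_i ('X - (h i)%:P) ->
  \prod_i \prod_(j | j != i) `|h i - h j| = (hyperfactorial n)%:R.
Proof.
case: n h => [|n] h hE; first by rewrite big_ord0 /hyperfactorial big_geq.
have tE : hermite R n.+1 = \prod_(z <- codom h) ('X - z%:P).
  by rewrite big_map big_enum.
have := hermite_resultant tE; rewrite big_map big_enum /= => res.
transitivity (\prod_(i < n.+1) `|(hermite R n.+1)^`().[h i]|).
  by apply: eq_bigr => i _; rewrite hE deriv_prod_XsubC_root normr_prod.
under eq_bigr do rewrite deriv_hermite hornerMn -mulr_natl normrM normr_nat.
rewrite big_split /= prodr_const card_ord -normr_prod res.
by rewrite hyperfactorialS natrM natrX mulrC.
Qed.

(** * Cauchy-Schwarz, AM-GM and the Stieltjes bound *)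

Lemma cauchy_schwarz_sum (R : realFieldType) (I : finType) (u v : I -> R) :
  (\sum_i u i * v i) ^+ 2 <= (\sum_i u i ^+ 2) * (\sum_i v i ^+ 2).
Proof.
set T := \sum_i _ * _; set U := \sum_i u i ^+ 2; set V := \sum_i v i ^+ 2.
have [V0|Vn0] := eqVneq V 0.
  suff -> : T = 0 by rewrite V0 mulr0 expr0n.
  apply: big1 => i _; have /eqP := V0.
  rewrite psumr_eq0 => [/allP/(_ i)|j _]; last exact: sqr_ge0.
  by rewrite mem_index_enum sqrf_eq0 => /(_ isT)/eqP ->; rewrite mulr0.
have Vgt0 : 0 < V by rewrite lt_def Vn0 sumr_ge0 // => i _; exact: sqr_ge0.
(* This sum expands to [V * (U * V - T ^+ 2)], and the positive factor [V] can be cancelled. *)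
have : 0 <= \sum_i (V * u i - T * v i) ^+ 2.
  by apply: sumr_ge0 => *; exact: sqr_ge0.
suff -> : \sum_i (V * u i - T * v i) ^+ 2 = V * (U * V - T ^+ 2).
  by rewrite pmulr_rge0 // subr_ge0.
transitivity (\sum_i (V ^+ 2 * u i ^+ 2 - 2%:R * V * T * (u i * v i)
                     + T ^+ 2 * v i ^+ 2)).
  by apply: eq_bigr => i _; ring.
by rewrite big_split sumrB /= -!mulr_sumr -/T -/U -/V; ring.
Qed.

Lemma prod_pair_le_hermite (R : rcfType) n (y : 'I_n -> R) : (1 < n)%N ->
  {homo y : i j / (i < j)%N >-> i <= j} ->
  \prod_i \prod_(j | j != i) `|y i - y j| <=
  (hyperfactorial n)%:R * ((\sum_i y i ^+ 2) / (n * n.-1)%:R) ^+ 'C(n, 2).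
Proof.
move=> n1 y_le; have [h h_lt hE] := hermite_zeros R n.
have hI := homo_ltn_inj h_lt.
pose M := (n * n.-1)%N; pose T := \sum_i y i * h i; pose V := \sum_i y i ^+ 2.
have M0 : 0 < M%:R :> R by rewrite ltr0n muln_gt0 ltnW //= -subn1 subn_gt0.
pose r (p : 'I_n * 'I_n) := (y p.1 - y p.2) / (h p.1 - h p.2).
have prE : \prod_i \prod_(j | j != i) `|y i - y j| =
    (hyperfactorial n)%:R * \prod_(p | p.2 != p.1) `|r p|.
  rewrite -(hermite_discriminant hE) -(pair_big_dep xpredT (fun i j => j != i)
    (fun i j => `|r (i, j)|)) -big_split; apply: eq_bigr => i _ /=.
  rewrite -big_split; apply: eq_bigr => j ji /=.
  rewrite /r /= normrM normfV mulrC divfK // normr_eq0.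
  by apply: contraNneq ji => /subr0_eq/hI ->.
(* AM-GM needs nonnegative ratios: [y] and [h] are ordered alike, and the diagonal gives 0. *)
have r0 p : 0 <= r p.
  case: p => i j; rewrite /r /=; case: (ltngtP i j) => [ij|ij|/val_inj ->].
  - rewrite -mulrNN -invrN !opprB mulr_ge0 ?invr_ge0 // subr_ge0.
      exact: y_le.
    exact/ltW/h_lt.
  - rewrite mulr_ge0 ?invr_ge0 // subr_ge0; first exact: y_le.
    exact/ltW/h_lt.
  - by rewrite subrr mul0r.
rewrite prE ler_wpM2l // (eq_bigr r) => [|p _]; last by rewrite ger0_norm.
have cardM : #|[pred p : 'I_n * 'I_n | p.2 != p.1]| = M.
  rewrite -sum1_card -(pair_big_dep xpredT (fun i j => j != i)
    (fun _ _ => 1%N)) /=.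
  under eq_bigr do rewrite sum1_card cardC1 card_ord.
  by rewrite sum_nat_const card_ord.
have := leif_AGM (A := [pred p : 'I_n * 'I_n | p.2 != p.1]) (in1W r0).
rewrite cardM => -[+ _]; move=> /le_trans; apply.
rewrite -(pair_big_dep xpredT (fun i j => j != i) (fun i j => r (i, j))) /=.
have -> : \sum_i \sum_(j | j != i) r (i, j) = T.
  exact: (sum_pair_quotient_hermite h_lt hE y).
(* Thus [(T / M) ^+ M] is the ['C(n, 2)]-th power of [(T / M) ^+ 2], and it remains to show
   [T ^+ 2 <= V * M]. *)
have M2 : M = (2 * 'C(n, 2))%N by rewrite -mul_bin_diag bin1.
rewrite {2}M2 exprM lerXn2r // ?nnegrE ?sqr_ge0 //.
  by rewrite divr_ge0 ?ler0n // sumr_ge0 // => i _; exact: sqr_ge0.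
rewrite expr_div_n ler_pdivrMr ?exprn_gt0 // expr2 mulrA divfK ?gt_eqF //.
rewrite -(sum_sqr_hermite h_lt hE).
exact: cauchy_schwarz_sum.
Qed.

Lemma sorting_perm (R : realDomainType) n (x : 'I_n -> R) :
  exists s : 'S_n, {homo (fun i => x (s i)) : i j / (i < j)%N >-> i <= j}.
Proof.
pose t := [tuple x i | i < n].
have [s sE] : exists s : 'S_n, sort <=%R t = [tuple tnth t (s i) | i < n].
  by apply/tuple_permP; rewrite perm_sort.
exists s => i j ij; have xE k : x (s k) = nth 0 (sort <=%R t) k.
  by rewrite sE -tnth_nth !tnth_mktuple.
rewrite !xE; apply: sorted_leq_nth; rewrite ?inE ?size_sort ?size_tuple //.
- exact: le_trans.
- exact: sort_le_sorted.
- exact: ltnW.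
Qed.

(** Both sides are invariant under permuting [x], so the sorted case suffices. *)
Lemma prod_pair_le (R : rcfType) n (x : 'I_n -> R) : (1 < n)%N ->
  \prod_i \prod_(j | j != i) `|x i - x j| <=
  (hyperfactorial n)%:R * ((\sum_i x i ^+ 2) / (n * n.-1)%:R) ^+ 'C(n, 2).
Proof.
move=> n1; have [s sx] := sorting_perm x.
have := prod_pair_le_hermite n1 sx.
have <- : \sum_i x i ^+ 2 = \sum_i x (s i) ^+ 2 by exact: (reindex_perm s).
move=> le_s; apply: le_trans le_s.
rewrite (reindex_perm s) /= le_eqVlt; apply/predU1P; left.
apply: eq_bigr => i _; rewrite (reindex_perm s) /=.
by apply: eq_bigl => j; rewrite (inj_eq perm_inj).
Qed.

(** * From the discriminant to the bound on [F] *)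

(** Each squared difference with [i < j] is shared between the ordered pairs [(i, j)] and
    [(j, i)]. *)
Lemma discriminantE (R : realType) n (x : 'rV[R]_n) :
  discriminant x = \prod_i \prod_(j | j != i) `|x 0 i - x 0 j|.
Proof.
transitivity (\prod_(i < n) \prod_(j < n | (i < j)%N) `|x 0 i - x 0 j|
            * \prod_(i < n) \prod_(j < n | (j < i)%N) `|x 0 i - x 0 j|).
  rewrite [X in _ * X](exchange_big_dep xpredT) //= -big_split.
  apply: eq_bigr => i _; rewrite -big_split /=; apply: eq_bigr => j _.
  by rewrite [X in _ * X]distrC -expr2 real_normK ?num_real.
rewrite -big_split; apply: eq_bigr => i _ /=.
rewrite [RHS](bigID (fun j : 'I_n => (i < j)%N)) /=.
by congr (_ * _); apply: eq_bigl => j; rewrite -val_eqE /=; lia.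
Qed.

Theorem theorem1p7 (R : realType) (n : nat) (a b c d S1 S2 : R) (x : 'rV[R]_n)
  (hn : (2 <= n)%N) (ha : 0 < a) (hS1 : 0 < S1) (hS2 : 0 < S2)
  (hlow : (n%:R - 1) * S2 < S1 ^+ 2) (hup : S1 ^+ 2 < n%:R * S2)
  (hx : forall i : 'I_n, 0 < x 0 i)
  (hsum : \sum_(i < n) x 0 i = S1)
  (hsum2 : \sum_(i < n) x 0 i ^+ 2 = S2) :
  F a b c d x >=
    'C(n, 2)%:R * (2%:R * a / n%:R)
      * (discriminant x / (hyperfactorial n)%:R) `^ ('C(n, 2)%:R)^-1
    + (a + b) * (S1 ^+ 2 / n%:R ^+ 2) + c * S1 / n%:R + d.
Proof.
pose m := S1 / n%:R; pose M : R := (n * n.-1)%:R.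
pose V := \sum_i (x 0 i - m) ^+ 2; pose N := 'C(n, 2).
have n0 : n%:R != 0 :> R by rewrite pnatr_eq0 -lt0n ltnW.
have N0 : N%:R != 0 :> R by rewrite pnatr_eq0 -lt0n bin_gt0.
have MN : M = 2%:R * N%:R.
  by rewrite /M -natrM /N -mul_bin_diag bin1.
have VE : V = S2 - S1 ^+ 2 / n%:R.
  transitivity (\sum_i (x 0 i ^+ 2 - 2%:R * m * x 0 i + m ^+ 2)).
    by apply: eq_bigr => i _; ring.
  rewrite big_split sumrB /= -mulr_sumr hsum hsum2 sumr_const card_ord.
  by rewrite -mulr_natl /m; field.
have V0 : 0 <= V / M.
  by rewrite divr_ge0 ?ler0n // sumr_ge0 // => i _; exact: sqr_ge0.
have Y0 : 0 < (hyperfactorial n)%:R :> R.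
  rewrite ltr0n /hyperfactorial big_nat_cond; apply: prodn_cond_gt0 => k.
  by rewrite andbT expn_gt0 => /andP[k2 _]; rewrite (ltnW k2).
(* Differences ignore a shift by the mean [m], so the bound applies to the centred variables, whose
   sum of squares is [V]. *)
have discV : discriminant x / (hyperfactorial n)%:R <= (V / M) ^+ N.
  rewrite ler_pdivrMr // mulrC discriminantE.
  apply: le_trans (prod_pair_le (fun i => x 0 i - m) hn).
  rewrite le_eqVlt; apply/predU1P; left.
  apply: eq_bigr => i _; apply: eq_bigr => j _; congr `|_|; ring.
have D0 : 0 <= discriminant x / (hyperfactorial n)%:R.
  rewrite divr_ge0 // prodr_ge0 // => i _.
  by apply: prodr_ge0 => j _; exact: sqr_ge0.
have powV : (discriminant x / (hyperfactorial n)%:R) `^ N%:R^-1 <= V / M.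
  have -> : V / M = ((V / M) ^+ N) `^ N%:R^-1.
    by rewrite -powR_mulrn // -powRrM mulfV // powRr1.
  by apply: ge0_ler_powR; rewrite ?nnegrE ?exprn_ge0 // invr_ge0 ler0n.
rewrite /F hsum hsum2 -subr_ge0.
set D := _ `^ _ in powV *.
(* As [S2 = V + S1^2/n] and [M = 2 N], everything but a multiple of [V / M - D] cancels. *)
have -> : a / n%:R * S2 + b / n%:R ^+ 2 * S1 ^+ 2 + c / n%:R * S1 + d -
   (N%:R * (2%:R * a / n%:R) * D + (a + b) * (S1 ^+ 2 / n%:R ^+ 2)
    + c * S1 / n%:R + d) = a / n%:R * M * (V / M - D).
  by rewrite MN VE; field; rewrite n0 N0.
by rewrite !mulr_ge0 ?subr_ge0 ?invr_ge0 ?ler0n // ltW.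
Qed.
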